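(* Consider a dynamic stochastic block model (DSBM) with $n$ nodes, $L$ time instants and true tensor of connection probabilities $\Lambda^*\in[0,1]^{n\times n\times L}$, with vectorized version $\theta^*\in\mathbb R^{NL}$, $N=n(n-1)/2$. Let $H\in\mathbb R^{L\times L}$ be an orthogonal matrix. For each $m=1,\dots,n$ let $\mathcal C(m,n,L)\subseteq\prod_{l=1}^L\mathcal M(m,n)$ be a set of sequences of clustering matrices such that $\log|\mathcal C(m,n,L)|\ge 2\log m$. Let $\hat\Lambda$ be the penalized least squares estimator described in the context, with penalty $$\mathrm{Pen}(|J|,m)=11\log|\mathcal C(m,n,L)|+\frac{11}{2}|J|\log\Big(\frac{25\,m^2L}{|J|}\Big).$$ Then, for any $t>0$, with probability at least $1-9e^{-t}$, $$\frac{\|\hat\Lambda-\Lambda^*\|^2}{n^2L}\le\min_{m,J,d,\;C\in\mathcal C(m,n,L)}\left[\frac{6\,\|CW^Td_{(J)}-\theta^*\|^2}{n^2L}+\frac{4\,\mathrm{Pen}(|J|,m)}{n^2L}\right]+\frac{38\,t}{n^2L},$$ and $$\mathbb E\left(\frac{\|\hat\Lambda-\Lambda^*\|^2}{n^2L}\right)\le\min_{m,J,d,\;C\in\mathcal C(m,n,L)}\left[\frac{6\,\|CW^Td_{(J)}-\theta^*\|^2}{n^2L}+\frac{4\,\mathrm{Pen}(|J|,m)}{n^2L}+\frac{342}{n^2L}\right].$$ Here the minima are over $m\in\{1,\dots,n\}$, nonempty $J\subseteq\{1,\dots,ML\}$ with $M=m(m+1)/2$, $d\in\mathbb R^{ML}$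 and $C\in\mathcal C(m,n,L)$; $W=H\otimes I_M$; and $d_{(J)}$ is the vector $d$ with all elements $d_j$, $j\notin J$, set to zero.
   Context: Observations: $B_{i,j,l}\in\{0,1\}$ for $1\le i,j\le n$, $1\le l\le L$, with $B_{i,j,l}=B_{j,i,l}$, $B_{i,i,l}=0$, and $\{B_{i,j,l}: i<j,\ 1\le l\le L\}$ independent Bernoulli variables with $\mathbb P(B_{i,j,l}=1)=\Lambda^*_{i,j,l}$; $\Lambda^*_{i,i,l}=0$, $\Lambda^*_{i,j,l}=\Lambda^*_{j,i,l}$. Clustering matrices: $\mathcal M(m,n)$ is the set of matrices $Z\in\{0,1\}^{n\times m}$ with exactly one 1 in each row; $Z_{ik}=1$ iff node $i$ belongs to class $\Omega_k$. DSBM with $m$ classes: at each time $l$ the nodes are grouped into classes by a matrix $Z^{(l)}\in\mathcal M(m,n)$, and $\Lambda_{i,j,l}=G_{k,k',l}$ ($i\ne j$) if $i\in\Omega_k$, $j\in\Omega_{k'}$ at time $l$, where $G\in[0,1]^{m\times m\times L}$, $G_{k,k',l}=G_{k',k,l}$. Vectorization: $N=n(n-1)/2$, $M=m(m+1)/2$. $a^{(l)},\theta^{(l)}\in\mathbb R^N$ are the vectors of entries $B_{i_1,i_2,l}$, $\Lambda_{i_1,i_2,l}$ with $i_1<i_2$; $q^{(l)}\in\mathbb R^M$ is the vector of entries $G_{k_1,k_2,l}$ with $k_1\le k_2$. $C^{(l)}\in\{0,1\}^{N\times M}$ has entry 1 in the row of $(i_1,i_2)$ and the column of $(k_1,k_2)$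 iff, under $Z^{(l)}$, one of the nodes $i_1,i_2$ is in $\Omega_{k_1}$ and the other is in $\Omega_{k_2}$. $a,\theta\in\mathbb R^{NL}$ and $q\in\mathbb R^{ML}$ are obtained by stacking over $l=1,\dots,L$, and $C\in\{0,1\}^{NL\times ML}$ is block diagonal with blocks $C^{(1)},\dots,C^{(L)}$, so that $\theta=Cq$. A sequence $(Z^{(1)},\dots,Z^{(L)})\in\mathcal C(m,n,L)$ is identified with its matrix $C$, and one writes $C\in\mathcal C(m,n,L)$. $\theta^*$ is the vector $\theta$ obtained from $\Lambda^*$. Transform: $W=H\otimes I_M$ (orthogonal) and $d=Wq$, i.e. $d=\mathrm{vec}(QH^T)$ where $Q\in\mathbb R^{M\times L}$ has columns $q^{(l)}$. Estimator: $(\hat m,\hat J,\hat d,\hat C)$ is any minimizer of $\|a-CW^Td\|^2+\mathrm{Pen}(|J|,m)$ over $m\in\{1,\dots,n\}$, nonempty $J\subseteq\{1,\dots,ML\}$, $d\in\mathbb R^{ML}$ with $d_j=0$ for $j\notin J$, and $C\in\mathcal C(m,n,L)$ ($M$, $W$ depend on $m$). With $\hat M=\hat m(\hat m+1)/2$ and $\hat W=H\otimes I_{\hat M}$ put $\hat\theta=\hat C\hat W^T\hat d$; $\hat\Lambda$ is the tensor, symmetric in its first two indices with zero diagonals $\hat\Lambda_{i,i,l}=0$, whose vectorized version is $\hat\theta$. Norms: $\|\cdot\|$ is the Euclidean norm for vectors and the square root of the sum of squared entries for tensors. *)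

(* Defs.v *)
(* MathComp / MathComp-Analysis. *)
From HB Require Import structures.
From mathcomp Require Import all_boot all_order all_algebra.
From mathcomp Require Import all_classical all_reals all_analysis.

Set Implicit Arguments.
Unset Strict Implicit.
Unset Printing Implicit Defensive.

Import Order.TTheory GRing.Theory Num.Theory.
Local Open Scope ring_scope.

(* Index sets of the vectorized tensors.  Coordinates r < N (resp. s < M) are
   matched with pairs through enum_val; the counts N = n(n-1)/2 and
   M = m(m+1)/2 are card_edge and card_cpair below. *)
Definition edge (n : nat) := {p : 'I_n * 'I_n | (p.1 < p.2)%N}.
Definition cpair (m : nat) := {p : 'I_m * 'I_m | (p.1 <= p.2)%N}.

Definition dimN (n : nat) : nat := #|{: edge n}|.
Definition dimM (m : nat) : nat := #|{: cpair m}|.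
Definition dimNL (n L : nat) : nat := (\sum_(l < L) dimN n)%N.
Definition dimML (m L : nat) : nat := (\sum_(l < L) dimM m)%N.

Definition edge_at (n : nat) (r : 'I_(dimN n)) : 'I_n * 'I_n :=
  val (enum_val r).
Definition cpair_at (m : nat) (s : 'I_(dimM m)) : 'I_m * 'I_m :=
  val (enum_val s).

Lemma card_ord_lt (n k : nat) : (k <= n)%N ->
  (\sum_(i < n | (i < k)%N) 1 = k)%N.
Proof.
by move=> le_kn; rewrite -(big_ord_widen n (fun=> 1%N) le_kn) sum1_card card_ord.
Qed.

Lemma card_edge (n : nat) : dimN n = ((n * n.-1)./2)%N.
Proof.
rewrite /dimN card_sig -sum1_card.
rewrite -(pair_big_dep xpredT (fun i j : 'I_n => (i < j)%N)
            (fun _ _ => 1%N)) /=.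
rewrite (exchange_big_dep xpredT) //=.
under eq_bigr => j _ do rewrite (card_ord_lt (ltnW (ltn_ord j))).
by rewrite -(big_mkord xpredT id) bin2_sum bin2.
Qed.

Lemma card_cpair (m : nat) : dimM m = ((m * m.+1)./2)%N.
Proof.
rewrite /dimM card_sig -sum1_card.
rewrite -(pair_big_dep xpredT (fun i j : 'I_m => (i <= j)%N)
            (fun _ _ => 1%N)) /=.
rewrite (exchange_big_dep xpredT) //=.
under eq_bigr => j _ do rewrite (card_ord_lt (ltn_ord j)).
rewrite -(big_mkord xpredT S) mulnC -(bin2 m.+1) -bin2_sum.
by rewrite [RHS]big_nat_recl.
Qed.

Section Deterministic.
Variable R : realType.

(* A tensor Lam i j l carries its third (time) index as a last argument. *)
Definition tensor (n L : nat) := 'I_n -> 'I_n -> 'I_L -> R.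

Definition sqnorm (k : nat) (v : 'cV[R]_k) : R := \sum_i v i 0 ^+ 2.

Definition sqnorm_tensor (n L : nat) (Lam : tensor n L) : R :=
  \sum_i \sum_j \sum_l Lam i j l ^+ 2.

Definition sym0_tensor (n L : nat) (Lam : tensor n L) : Prop :=
  (forall i j l, Lam i j l = Lam j i l) /\ (forall i l, Lam i i l = 0).

Definition vectorize (n L : nat) (Lam : tensor n L) : 'cV[R]_(dimNL n L) :=
  \mxcol_(l < L) \col_r Lam (edge_at r).1 (edge_at r).2 l.

Definition clustering (m n : nat) : {set 'M[bool]_(n, m)} :=
  [set Z : 'M[bool]_(n, m) | [forall i, #|[set k | Z i k]| == 1%N]].

Definition clustering_seq (m n L : nat) := {ffun 'I_L -> 'M[bool]_(n, m)}.

Definition dsbm (m n L : nat) (Lam : tensor n L) : Prop :=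
  exists (Z : clustering_seq m n L) (G : tensor m L),
    [/\ forall l, Z l \in clustering m n,
        forall k k' l, 0 <= G k k' l <= 1,
        forall k k' l, G k k' l = G k' k l
      & forall i j k k' l, i != j -> Z l i k -> Z l j k' ->
          Lam i j l = G k k' l].

(* Allowing as many classes as nodes, the model imposes no structure. *)
Lemma dsbm_all (n L : nat) (Lam : tensor n L) :
  sym0_tensor Lam -> (forall i j l, 0 <= Lam i j l <= 1) -> dsbm n Lam.
Proof.
move=> [Lsym _] L01; exists [ffun=> \matrix_(i, k) (i == k)], Lam; split=> //.
- move=> l; rewrite ffunE inE; apply/forallP => i.
  rewrite -(cards1 i); apply/eqP; congr #|pred_of_set _|.
  by apply/setP => k; rewrite !inE mxE eq_sym.
- by move=> i j k k' l _; rewrite ffunE !mxE => /eqP <- /eqP <-.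
Qed.

Definition Cblock (m n : nat) (Z : 'M[bool]_(n, m)) :
    'M[R]_(dimN n, dimM m) :=
  \matrix_(r, s)
    (let: (i1, i2) := edge_at r in let: (k1, k2) := cpair_at s in
     (Z i1 k1 && Z i2 k2) || (Z i1 k2 && Z i2 k1))%:R.

Definition Cmx (m n L : nat) (Z : clustering_seq m n L) :
    'M[R]_(dimNL n L, dimML m L) :=
  \mxblock_(l < L, l' < L) (if l == l' then Cblock (Z l) else 0).

(* The Kronecker product H (x) I_M, written by blocks. *)
Definition Wmx (m L : nat) (H : 'M[R]_L) : 'M[R]_(dimML m L) :=
  \mxblock_(l < L, l' < L) (H l l' *: (1%:M : 'M[R]_(dimM m))).

(* (m, J, d, C), the matrix C being given by its clustering sequence. *)
Record candidate (n L : nat) := Candidate {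
  cl : nat;
  supp : {set 'I_(dimML cl L)};
  coef : 'cV[R]_(dimML cl L);
  clus : clustering_seq cl n L }.

Definition restrict (k : nat) (J : {set 'I_k}) (v : 'cV[R]_k) : 'cV[R]_k :=
  \col_j (if j \in J then v j 0 else 0).

Definition fit (n L : nat) (H : 'M[R]_L) (c : candidate n L)
    (v : 'cV[R]_(dimML (cl c) L)) : 'cV[R]_(dimNL n L) :=
  Cmx (clus c) *m (Wmx (cl c) H)^T *m v.

Arguments fit {n L} H c v.

Section Family.
Variables (n L : nat) (H : 'M[R]_L).
Variable CC : forall m : nat, {set clustering_seq m n L}.

Definition pen (j m : nat) : R :=
  11 * ln #|CC m|%:R
  + 11 / 2 * j%:R * ln (25 * m%:R ^+ 2 * L%:R / j%:R).

Definition admissible (c : candidate n L) : Prop :=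
  [/\ (1 <= cl c <= n)%N, (0 < #|supp c|)%N & clus c \in CC (cl c)].

Definition feasible (c : candidate n L) : Prop :=
  admissible c /\ forall j, j \notin supp c -> coef c j 0 = 0.

Definition objective (a : 'cV[R]_(dimNL n L)) (c : candidate n L) : R :=
  sqnorm (a - fit H c (coef c)) + pen #|supp c| (cl c).

Definition penalized_ls (a : 'cV[R]_(dimNL n L)) (c : candidate n L) : Prop :=
  feasible c /\ forall c', feasible c' -> objective a c <= objective a c'.

Definition oracle_risk (theta : 'cV[R]_(dimNL n L)) (c : candidate n L) : R :=
  6 * sqnorm (fit H c (restrict (supp c) (coef c)) - theta)
    / (n%:R ^+ 2 * L%:R)
  + 4 * pen #|supp c| (cl c) / (n%:R ^+ 2 * L%:R).

End Family.
End Deterministic.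

Arguments fit {R n L} H c v.

Local Open Scope classical_set_scope.

Definition is_min (R : realType) (S : set R) (b : R) : Prop :=
  S b /\ lbound S b.

Section Random.
Context {d : measure_display} {T : measurableType d} {R : realType}.
Variable P : probability T R.

Definition mutually_independent (I : finType) (d' : measure_display)
    (U : measurableType d') (X : I -> T -> U) : Prop :=
  forall (A : {set I}) (E : I -> set U), (forall i, measurable (E i)) ->
    P (\bigcap_(i in [set` A]) X i @^-1` E i) =
    (\prod_(i in A) P (X i @^-1` E i))%E.

Definition bernoulli_observations (n L : nat)
    (B : 'I_n -> 'I_n -> 'I_L -> {RV P >-> bool}) (Lam : tensor R n L) : Prop :=
  [/\ forall i j l w, B i j l w = B j i l w,
      forall i l w, B i i l w = false,
      forall i j l, P [set w | B i j l w] = (Lam i j l)%:E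
    & mutually_independent
        (fun (x : edge n * 'I_L) w => B (val x.1).1 (val x.1).2 x.2 w)].

Definition observation_vector (n L : nat)
    (B : 'I_n -> 'I_n -> 'I_L -> {RV P >-> bool}) (w : T) :
    'cV[R]_(dimNL n L) :=
  vectorize (fun i j l => (B i j l w)%:R).

End Random.

(* Main.v *)
(* Write a = theta^* + xi.  Comparing the objective at the estimator with its value
   at an oracle candidate c0 leaves to bound the linear terms
   2 <xi, thetahat - theta^*> and 2 <xi, theta^* - theta_c0>.  The vector
   thetahat - theta^* lies in the span V of theta^* and the |Jhat| selected columns
   of C W^T, of dimension at most |Jhat| + 1, hence
   2 <xi, thetahat - theta^*> <= |thetahat - theta^*|^2 / 2 + 2 |Pi_V xi|^2.

   The square |Pi_V xi|^2 is controlled without Gaussian integrals: exp(z^2) is at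
   most 3 times a finite sum of terms exp(s z - s^2/4), s on a grid of mesh 4, so
   exp(|Pi_V xi|^2) is bounded by a finite positive combination of exponentials of
   linear forms in xi, of expectation at most 8^(dim V) by Hoeffding's lemma.
   Summing over the models (m, J, C) with weights exp(-Pen/2), and adding the term
   of the one-dimensional space containing theta^* - theta_c0, gives an explicit
   F(xi) >= 1 with E F <= 9 and
   2 |thetahat - theta^*|^2 <= 6 |theta_c0 - theta^*|^2 + 4 Pen + 16 ln F,
   whose left-hand side is the tensor loss.  Markov's inequality for F yields the
   first claim, and ln F <= F - 1 the second. *)
Require Import Defs.
From mathcomp Require Import all_boot all_order all_algebra.
From mathcomp Require Import all_classical all_reals all_analysis.
From mathcomp Require Import measurable_realfun ring lra.

Set Implicit Arguments.
Unset Strict Implicit.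
Unset Printing Implicit Defensive.

Import Order.TTheory GRing.Theory Num.Theory numFieldNormedType.Exports.
Local Open Scope classical_set_scope.
Local Open Scope ring_scope.

(** * Exponential inequalities for one variable *)

(** Since e^(-1/8) >= 7/8, the number e = (e^(1/8))^8 is at most (8/7)^8 < 3. *)
Lemma expR1_le3 (R : realType) : expR 1 <= 3 :> R.
Proof.
have e8 : expR (1 / 8) <= 8 / 7 :> R.
  have := expR_ge1Dx (- (1 / 8) : R).
  rewrite expRN => h; rewrite -[leLHS]invrK -[leRHS]invrK lef_pV2; first last.
  - by rewrite posrE; lra.
  - by rewrite posrE invr_gt0 expR_gt0.
  by apply: le_trans h; lra.
have -> : 1 = 8%:R * (1 / 8) :> R by field.
rewrite expRM_natl; apply: (@le_trans _ _ ((8 / 7) ^+ 8)); last by lra.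
by rewrite lerXn2r // nnegrE ?expR_ge0 //; lra.
Qed.

(** The quotient r^r / r! is a single term of the exponential series at [r]. *)
Lemma ler_exp_fact (R : realType) (r : nat) :
  r%:R ^+ r <= r`!%:R * expR r%:R :> R.
Proof.
case: r => [|r]; first by rewrite expr0 fact0 mul1r expR0.
have := expR_ge1Dxn r (ler0n R r.+1).
rewrite -ler_pdivrMl ?ltr0n ?fact_gt0 // mulrC; apply: le_trans.
by rewrite lerDr.
Qed.

Lemma is_derive_ge0_ge (R : realType) (f df : R -> R) (x : R) :
  (forall y : R, 0 <= y -> is_derive y (1 : R) f (df y)) ->
  (forall y, 0 <= y -> 0 <= df y) -> 0 <= x -> f 0 <= f x.
Proof.
move=> Df df0 x0.
apply: (@ger0_derive1_ndecry _ f 0) => //.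
- by move=> y /[!in_itv]/= /[!andbT] /ltW y0; have [] := Df y y0.
- move=> y /[!in_itv]/= /[!andbT] /ltW y0.
  by rewrite derive1E; have [_ ->] := Df y y0; exact: df0.
- apply: derivable_within_continuous => y /[!in_itv]/= /[!andbT] y0.
  by have [] := Df y y0.
Qed.

Lemma is_derive_mgf (R : realType) (p x : R) :
  is_derive x (1 : R) (fun x => 1 - p + p * expR x) (p * expR x).
Proof.
have -> : (fun x => 1 - p + p * expR x) = cst (1 - p) + p \*: (expR : R -> R).
  by apply/funext.
by eapply is_derive_eq; [exact: is_deriveD|rewrite add0r].
Qed.

(** [dD] is its own derivative at [x], as for [1 - p + p * expR x], so the quotient rule takes the
    form (D - dD) dD / D^2. *)
Lemma is_derive_slope (R : realType) (p x : R) (D dD : R -> R) :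
  D x != 0 -> is_derive x (1 : R) D (dD x) ->
  is_derive x (1 : R) dD (dD x) ->
  is_derive x (1 : R) (fun x => x / 4 + p - dD x / D x)
    (1 / 4 - (D x - dD x) * dD x / D x ^+ 2).
Proof.
move=> Dn D1 D2.
have D3 : is_derive x (1 : R) (fun z => (D z)^-1) (- D x ^- 2 * dD x).
  apply: DeriveDef; first by apply: derivableV => //; exact: ex_derive.
  by rewrite deriveV // derive_val.
have -> : (fun x => x / 4 + p - dD x / D x) =
    (4^-1 \*: id + cst p) - dD * (fun z => (D z)^-1).
  by apply/funext => z; rewrite [z / 4]mulrC.
have D4 := is_deriveD (is_deriveZ 4^-1 (is_derive_id x (1 : R)))
  (is_derive_cst p x (1 : R)).
apply: (@is_derive_eq _ _ _ _ _ _ _ _ (is_deriveB D4 (is_deriveM D2 D3))).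
rewrite /GRing.scale/=; move: (D x) (dD x) Dn => u v un.
by field.
Qed.

Lemma is_derive_log_mgf (R : realType) (p x : R) (D dD : R -> R) :
  0 < D x -> is_derive x (1 : R) D (dD x) ->
  is_derive x (1 : R) (fun x => x ^+ 2 / 8 + p * x - ln (D x))
    (x / 4 + p - dD x / D x).
Proof.
move=> D0 D1.
have D3 : is_derive x (1 : R) (fun z => ln (D z)) ((D x)^-1 * dD x).
  by apply: is_derive1_comp; exact: is_derive1_ln.
have -> : (fun x => x ^+ 2 / 8 + p * x - ln (D x)) =
    8^-1 \*: ((id : R -> R) * id) + p \*: id - (fun z => ln (D z)).
  by apply/funext => z; rewrite expr2 [z * z / 8]mulrC.
have D2 := is_deriveD
  (is_deriveZ 8^-1 (is_deriveM (is_derive_id x (1 : R)) (is_derive_id x (1 : R))))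
  (is_deriveZ p (is_derive_id x (1 : R))).
apply: (@is_derive_eq _ _ _ _ _ _ _ _ (is_deriveB D2 D3)).
rewrite /GRing.scale/=; move: (D x) (dD x) D0 => u v /lt0r_neq0 un.
by field.
Qed.

(** After taking logarithms the claim is f(s) >= 0 for f(s) = s^2/8 + p s - ln D(s), D(s) = 1 - p +
    p e^s. Both f and f' = g vanish at 0, and f'' = 1/4 - u(1 - u) >= 0 with u = p e^s / D(s). *)
Lemma hoeffding_bernoulli_ge0 (R : realType) (p s : R) :
  0 <= p <= 1 -> 0 <= s ->
  p * expR (s * (1 - p)) + (1 - p) * expR (- (s * p)) <= expR (s ^+ 2 / 8).
Proof.
move=> /andP[p0 p1] s0.
pose D (x : R) := 1 - p + p * expR x.
have D_gt0 x : 0 <= x -> 0 < D x.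
  move=> x0; have : 1 <= expR x by rewrite -expR0 ler_expR.
  by rewrite /D; nra.
have dD x : is_derive x (1 : R) D (p * expR x) := is_derive_mgf p x.
pose g (x : R) := x / 4 + p - p * expR x / D x.
have g_ge0 x : 0 <= x -> 0 <= g x.
  move=> x0; have -> : 0 = g 0.
    by rewrite /g /D expR0 mulr1 subrK divr1 mul0r add0r subrr.
  apply: (@is_derive_ge0_ge _ g
    (fun y => 1 / 4 - (D y - p * expR y) * (p * expR y) / D y ^+ 2)) => [y y0|y y0|].
  - exact: (@is_derive_slope R p y D (fun y => p * expR y)
      (lt0r_neq0 (D_gt0 y y0)) (dD y) (is_deriveZ p (is_derive_expR y))).
  - rewrite subr_ge0 ler_pdivrMr ?exprn_gt0 ?D_gt0 //.
    move: (D y) (p * expR y) => u v.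
    by have := sqr_ge0 (u - 2 * v); nra.
  - exact: x0.
pose f (x : R) := x ^+ 2 / 8 + p * x - ln (D x).
have f_ge0 : 0 <= f s.
  have -> : 0 = f 0.
    by rewrite /f /D expR0 mulr1 subrK ln1 mulr0 expr0n mul0r !addr0 subrr.
  apply: (@is_derive_ge0_ge _ f g) => [y y0|y y0|].
  - exact: (@is_derive_log_mgf R p y D (fun y => p * expR y) (D_gt0 y y0) (dD y)).
  - exact: g_ge0.
  - exact: s0.
have -> : p * expR (s * (1 - p)) + (1 - p) * expR (- (s * p)) =
    expR (- (p * s)) * D s.
  have -> : s * (1 - p) = - (p * s) + s by ring.
  by rewrite expRD [s * p]mulrC /D; ring.
rewrite -[D s]lnK ?posrE ?D_gt0 // -expRD ler_expR.
by move: f_ge0; rewrite /f; lra.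
Qed.

(** Negative [s] is handled by exchanging the two outcomes: [p] becomes [1 - p] and [s] becomes
    [- s]. The form [0 - p] is the centred value [b%:R - p] at [b = false]. *)
Lemma hoeffding_bernoulli (R : realType) (p s : R) : 0 <= p <= 1 ->
  p * expR (s * (1 - p)) + (1 - p) * expR (s * (0 - p)) <= expR (s ^+ 2 / 8).
Proof.
move=> hp; rewrite sub0r mulrN.
have [s0|/ltW s0] := leP 0 s; first exact: hoeffding_bernoulli_ge0.
have hp' : 0 <= 1 - p <= 1 by lra.
have ns0 : 0 <= - s by rewrite oppr_ge0.
have := hoeffding_bernoulli_ge0 hp' ns0.
rewrite sqrrN addrC; congr (_ * expR _ + _ * expR _ <= _); ring.
Qed.

(* Twice the value at [j = 0] is counted: both signs give the same point. *)
Definition node (R : realType) (K : nat) (x : bool * 'I_K.+1) : R :=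
  (-1) ^+ x.1 * (4 * x.2%:R).

(* With s the grid point nearest to 2z, s z - s^2/4 = z^2 - (s - 2z)^2/4. *)
Lemma expR_sqr_le_nodes (R : realType) (K : nat) (z : R) : `|z| <= K%:R ->
  expR (z ^+ 2) <=
  3 * \sum_(x : bool * 'I_K.+1) expR (node R x * z - node R x ^+ 2 / 4).
Proof.
(* [j] is |z|/2 rounded to the nearest integer, so 2j is within 1 of |z|: the exponent loses at most
   1, which the factor 3 >= e pays for. *)
move=> zK; pose j := Num.truncn (`|z| / 2 + 1 / 2).
have u0 : 0 <= `|z| / 2 + 1 / 2 by have := normr_ge0 z; lra.
have /andP[j1 j2] := Num.Theory.truncn_itv u0.
have jK : (j < K.+1)%N.
  rewrite -(ltr_nat R); apply: le_lt_trans j1 _.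
  by have := ler0n R K; rewrite -[K.+1]addn1 natrD; lra.
pose x0 : bool * 'I_K.+1 := (z < 0, Ordinal jK).
apply: (@le_trans _ _ (3 * expR (node R x0 * z - node R x0 ^+ 2 / 4))); last first.
  rewrite ler_pM2l // (bigD1 x0) //= lerDl sumr_ge0 // => *; exact: expR_ge0.
apply: (@le_trans _ _ (expR 1 * expR (node R x0 * z - node R x0 ^+ 2 / 4))).
  rewrite -expRD ler_expR /node /= -/j exprMn sqrr_sign mul1r mulrAC.
  have -> : (-1) ^+ (z < 0)%R * z = `|z| by rewrite normrEsign.
  have -> : z ^+ 2 = `|z| ^+ 2 by rewrite real_normK ?num_real.
  move: j1 j2; rewrite -/j -[j.+1]addn1 natrD; set a := `|z|; set k := j%:R => j1 j2.
  have : (2 * k - a) ^+ 2 <= 1 by rewrite -ler_sqrt // sqrtr_sqr sqrtr1 ler_norml; lra.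
  nra.
by rewrite ler_pM2r ?expR_gt0 ?expR1_le3.
Qed.

Lemma sum_exprV4_le (R : realType) (K : nat) :
  \sum_(j < K) (4^-1) ^+ j <= 4 / 3 :> R.
Proof.
suff : \sum_(j < K) (4^-1) ^+ j <= 4 / 3 - 4 / 3 * (4^-1) ^+ K :> R.
  have : 0 <= (4^-1) ^+ K :> R by rewrite exprn_ge0.
  by lra.
elim: K => [|K IH]; first by rewrite big_ord0; lra.
by rewrite big_ord_recr /= exprS; lra.
Qed.

(** Hoeffding's e^(s^2/8) against the weight e^(-s^2/4) leaves e^(-s^2/8), which at |s| = 4j equals
    e^(-2j^2) <= 4^(-j). Both signs together give 3 * 2 * 4/3 = 8, the price of one dimension. *)
Lemma nodes_mass (R : realType) (K : nat) :
  3 * \sum_(x : bool * 'I_K.+1) expR (- (node R x ^+ 2 / 8)) <= 8 :> R.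
Proof.
have H j : expR (- ((4 * j%:R) ^+ 2 / 8)) <= (4^-1) ^+ j :> R.
  have e4 : expR (- 2) <= 4^-1 :> R.
    rewrite expRN lef_pV2 ?posrE ?expR_gt0 //.
    have -> : (2 : R) = 2%:R * 1 by rewrite mulr1.
    rewrite expRM_natl; have := expR_ge1Dx (1 : R); nra.
  apply: (@le_trans _ _ (expR (- 2) ^+ j)); last first.
    by rewrite lerXn2r ?nnegrE ?expR_ge0.
  rewrite -expRM_natl ler_expR.
  have [->|j0] := posnP j; first by lra.
  have : 1 <= j%:R :> R by rewrite ler1n.
  nra.
have -> : \sum_(x : bool * 'I_K.+1) expR (- (node R x ^+ 2 / 8)) =
  \sum_(b : bool) \sum_(j < K.+1) expR (- ((4 * j%:R) ^+ 2 / 8)).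
  rewrite pair_big /=; apply: eq_bigr => x _.
  by rewrite /node exprMn sqrr_sign mul1r.
rewrite sumr_const card_bool -mulr_natl.
have := le_trans (ler_sum (index_enum 'I_K.+1) (fun j _ => H j)) (sum_exprV4_le R K.+1).
lra.
Qed.

(** * Orthonormal bases and least squares *)

Definition dot (R : realType) (N : nat) (u v : 'cV[R]_N) : R := \sum_i u i 0 * v i 0.

Lemma dotE (R : realType) (N : nat) (u v : 'cV[R]_N) : dot u v = (u^T *m v) 0 0.
Proof. by rewrite mxE; apply: eq_bigr => i _; rewrite mxE. Qed.

Lemma dot_trmul (R : realType) (k N : nat) (E : 'M[R]_(k, N)) (u : 'cV[R]_N)
    (w : 'cV[R]_k) : dot u (E^T *m w) = dot (E *m u) w.
Proof. by rewrite !dotE trmx_mul mulmxA. Qed.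

Lemma sqnorm_dot (R : realType) (N : nat) (v : 'cV[R]_N) : sqnorm v = dot v v.
Proof. by apply: eq_bigr => i _; rewrite expr2. Qed.

Lemma sqnorm_ge0 (R : realType) (N : nat) (v : 'cV[R]_N) : 0 <= sqnorm v.
Proof. by apply: sumr_ge0 => i _; exact: sqr_ge0. Qed.

Lemma sqnormN (R : realType) (N : nat) (v : 'cV[R]_N) : sqnorm (- v) = sqnorm v.
Proof. by apply: eq_bigr => i _; rewrite mxE sqrrN. Qed.

Lemma sqnormD (R : realType) (N : nat) (u v : 'cV[R]_N) :
  sqnorm (u + v) = sqnorm u + 2 * dot u v + sqnorm v.
Proof.
rewrite /sqnorm /dot mulr_sumr -!big_split /=; apply: eq_bigr => i _.
by rewrite mxE; ring.
Qed.

Lemma sqnorm_trmul (R : realType) (k N : nat) (E : 'M[R]_(k, N)) (w : 'cV[R]_k) :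
  E *m E^T = 1%:M -> sqnorm (E^T *m w) = sqnorm w.
Proof. by move=> EE; rewrite !sqnorm_dot dot_trmul mulmxA EE mul1mx. Qed.

(** Gram-Schmidt on the rows of [A], by induction on their number; [k < r] when the rows are
    dependent. *)
Lemma orthonormal_basis (R : realType) (r N : nat) (A : 'M[R]_(r, N)) :
  exists (k : nat) (E : 'M[R]_(k, N)),
    [/\ (k <= r)%N, E *m E^T = 1%:M, (A <= E)%MS & (E <= A)%MS].
Proof.
elim: r A => [|r IH] A.
  by exists 0%N, A; rewrite submx_refl; split=> //; rewrite [LHS]flatmx0 [RHS]flatmx0.
have [k [E [kr EE AE EA]]] := IH (@dsubmx R 1 r N A).
have AU : A = col_mx (@usubmx R 1 r N A) (@dsubmx R 1 r N A).
  by rewrite vsubmxK.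
move: AU AE EA; move: (usubmx _) (dsubmx _) => a A' AU AE EA.
(* [v] is the component of the first row orthogonal to the basis [E] of the other rows. If it
   vanishes [E] is kept, otherwise it is normalized and added. *)
pose v := a - a *m E^T *m E.
have vE : v *m E^T = 0 by rewrite mulmxBl -!mulmxA EE mulmx1 subrr.
have aE : a = v + a *m E^T *m E by rewrite subrK.
have sA := eqmx_sym (addsmxE a A').
have EA2 : (E <= A)%MS.
  by apply: submx_trans EA _; rewrite AU sA addsmxSr.
have aA : (a <= A)%MS by rewrite AU sA addsmxSl.
have [v0|v0] := eqVneq v 0.
  exists k, E; rewrite EE EA2 (leqW kr); split=> //.
  rewrite AU sA addsmx_sub AE andbT aE v0 add0r; exact: submxMl.
pose c := (v *m v^T) 0 0.
have cE : c = sqnorm v^T.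
  by rewrite sqnorm_dot dotE trmxK.
have c0 : 0 < c.
  rewrite lt_neqAle cE sqnorm_ge0 andbT eq_sym; apply: contra v0 => /eqP s0.
  apply/eqP/matrixP => i j; rewrite ord1 [RHS]mxE.
  have /(_ j isT)/eqP := psumr_eq0P (fun i _ => sqr_ge0 (v^T i 0)) s0.
  by rewrite sqrf_eq0 [_^T _ _]mxE => /eqP.
pose e := (Num.sqrt c)^-1 *: v.
have sc0 : Num.sqrt c != 0 by rewrite sqrtr_eq0 -ltNge.
have sE := eqmx_sym (addsmxE e E).
exists (1 + k)%N, (col_mx e E); split.
- by rewrite ltnS.
- rewrite tr_col_mx mul_col_mx !mul_mx_row.
  have -> : e *m e^T = 1%:M.
    rewrite /e linearZ /= -scalemxAl -scalemxAr scalerA.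
    rewrite [v *m _]mx11_scalar -/c -scalemx1 scalerA -invfM -expr2 sqr_sqrtr ?ltW //.
    by rewrite mulVf ?scale1r // lt0r_neq0.
  have -> : e *m E^T = 0 by rewrite -scalemxAl vE scaler0.
  have -> : E *m e^T = 0.
    by rewrite -[LHS]trmxK trmx_mul trmxK -scalemxAl vE scaler0 trmx0.
  by rewrite EE -[col_mx _ _]/(block_mx 1%:M 0 0 1%:M) -scalar_mx_block.
- rewrite AU sA addsmx_sub !sE; apply/andP; split; last first.
    by apply: submx_trans AE _; exact: addsmxSr.
  rewrite aE; apply: addmx_sub_adds; last exact: submxMl.
  have -> : v = Num.sqrt c *: e by rewrite /e scalerA divff // scale1r.
  exact: scalemx_sub.
- rewrite sE addsmx_sub EA2 andbT; apply: scalemx_sub.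
  rewrite /v; apply: addmx_sub => //; rewrite eqmx_opp.
  by apply: submx_trans (submxMl _ _) EA2.
Qed.

Lemma span_trmul (R : realType) (k N : nat) (E : 'M[R]_(k, N)) (v : 'cV[R]_N) :
  (v^T <= E)%MS -> exists w, v = E^T *m w.
Proof.
move=> /submxP [D vE]; exists D^T.
by rewrite -[LHS]trmxK vE trmx_mul.
Qed.

(** With v = E^T w one has <u, v> = <E u, w> and |v| = |w|; then 2xy <= x^2/2 + 2y^2 in each
    coordinate. *)
Lemma dot_le_proj (R : realType) (k N : nat) (E : 'M[R]_(k, N))
    (u v : 'cV[R]_N) : E *m E^T = 1%:M -> (v^T <= E)%MS ->
  2 * dot u v <= sqnorm v / 2 + 2 * sqnorm (E *m u).
Proof.
move=> EE /span_trmul [w ->]; rewrite dot_trmul sqnorm_trmul //.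
rewrite /sqnorm /dot mulr_suml !mulr_sumr -big_split /=; apply: ler_sum => i _.
by have := sqr_ge0 (w i 0 - 2 * (E *m u) i 0); nra.
Qed.

(** [A *m x0] is the orthogonal projection of [b] on the column span of [A]. This is what makes the
    minimum over [d] attained in the oracle. *)
Lemma least_squares (R : realType) (r N : nat) (A : 'M[R]_(N, r)) (b : 'cV[R]_N) :
  exists x0, forall x, sqnorm (A *m x0 - b) <= sqnorm (A *m x - b).
Proof.
have [k [E [_ EE AE EA]]] := orthonormal_basis A^T.
have [x0 Ex0] : exists x0, E^T *m (E *m b) = A *m x0.
  have [|x0 ->] := @span_trmul R r N A^T (E^T *m (E *m b)).
    by rewrite trmx_mul trmxK; apply: submx_trans (submxMl _ _) EA.
  by exists x0; rewrite trmxK.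
exists x0 => x.
have [w Ew] : exists w, A *m x - A *m x0 = E^T *m w.
  apply: span_trmul; rewrite -mulmxBr trmx_mul.
  by apply: submx_trans (submxMl _ _) AE.
have -> : A *m x - b = (A *m x0 - b) + E^T *m w by rewrite -Ew [RHS]addrC addrA subrK.
rewrite [leRHS]sqnormD dot_trmul mulmxBr -Ex0 (mulmxA E) EE mul1mx subrr.
have -> : dot (0 : 'cV_k) w = 0 by rewrite dotE trmx0 mul0mx mxE.
by rewrite mulr0 addr0 lerDl sqnorm_ge0.
Qed.

(** * Exponential moments of projected Bernoulli noise *)

Definition bern (R : realType) (p : R) (b : bool) : R := if b then p else 1 - p.

Definition mean (R : realType) (N : nat) (p : 'I_N -> R)
    (g : {ffun 'I_N -> bool} -> R) : R :=
  \sum_b g b * \prod_i bern (p i) (b i).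

Definition noise (R : realType) (N : nat) (p : 'I_N -> R)
    (b : {ffun 'I_N -> bool}) : 'cV[R]_N := \col_i ((b i)%:R - p i).

(** Majorant of exp(|E u|^2): each coordinate is replaced by its bound in [expR_sqr_le_nodes], so
    that expanding the product leaves only exponentials of linear forms in [u]. *)
Definition proj_mix (R : realType) (k N : nat) (E : 'M[R]_(k, N)) (K : nat)
    (u : 'cV[R]_N) : R :=
  \prod_i (3 * \sum_(x : bool * 'I_K.+1)
    expR (node R x * (E *m u) i 0 - node R x ^+ 2 / 4)).

Lemma dotC (R : realType) (N : nat) (u v : 'cV[R]_N) : dot u v = dot v u.
Proof. by apply: eq_bigr => i _; rewrite mulrC. Qed.

Lemma bern_ge0 (R : realType) (p : R) (b : bool) : 0 <= p <= 1 -> 0 <= bern p b.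
Proof. by case: b => /=; lra. Qed.

Section Mean.
Variables (R : realType) (N : nat) (p : 'I_N -> R).
Hypothesis p01 : forall i, 0 <= p i <= 1.

Lemma weight_ge0 (b : {ffun 'I_N -> bool}) : 0 <= \prod_i bern (p i) (b i).
Proof. by apply: prodr_ge0 => i _; exact: bern_ge0. Qed.

Lemma le_mean f g : (forall b, f b <= g b) -> mean p f <= mean p g.
Proof. by move=> fg; apply: ler_sum => b _; rewrite ler_wpM2r ?weight_ge0. Qed.

Lemma mean_sum (I : finType) (P : pred I) (c : I -> R) (g : I -> _ -> R) :
  mean p (fun b => \sum_(x | P x) c x * g x b) =
  \sum_(x | P x) c x * mean p (g x).
Proof.
rewrite /mean (eq_bigr (fun b =>
  \sum_(x | P x) c x * (g x b * \prod_i bern (p i) (b i)))); last first.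
  by move=> b _; rewrite mulr_suml; apply: eq_bigr => x _; rewrite mulrA.
by rewrite exchange_big /=; apply: eq_bigr => x _; rewrite mulr_sumr.
Qed.

Lemma meanD f g : mean p (fun b => f b + g b) = mean p f + mean p g.
Proof. by rewrite -big_split /=; apply: eq_bigr => b _; rewrite mulrDl. Qed.

Lemma mean_cst c : mean p (fun=> c) = c.
Proof.
rewrite /mean -mulr_sumr -(bigA_distr_bigA (fun i b => bern (p i) b)) /=.
rewrite big1 ?mulr1 // => i _.
by rewrite big_bool /= addrC subrK.
Qed.

Lemma meanZ c g : mean p (fun b => c * g b) = c * mean p g.
Proof. by rewrite /mean mulr_sumr; apply: eq_bigr => b _; rewrite mulrA. Qed.

Lemma noise_le1 b i : `|noise p b i 0| <= 1.
Proof. by rewrite mxE ler_norml; have := p01 i; case: (b i) => /=; lra. Qed.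

(** Weight and exponential are both products over coordinates, so the sum over outcomes factors into
    two-point sums, each bounded by Hoeffding's lemma. *)
Lemma mean_expR_dot (s : 'cV[R]_N) :
  mean p (fun b => expR (dot s (noise p b))) <= expR (sqnorm s / 8).
Proof.
rewrite /mean (eq_bigr (fun b : {ffun 'I_N -> bool} =>
   \prod_i (bern (p i) (b i) * expR (s i 0 * ((b i)%:R - p i))))); last first.
  move=> b _; rewrite /dot expR_sum mulrC -big_split /=.
  by apply: eq_bigr => i _; rewrite mxE.
rewrite -(bigA_distr_bigA (fun i c => bern (p i) c * expR (s i 0 * (c%:R - p i)))) /=.
rewrite /sqnorm mulr_suml expR_sum; apply: ler_prod => i _.
rewrite big_bool /= hoeffding_bernoulli // andbT.
have := p01 i.
by move=> ?; rewrite addr_ge0 ?mulr_ge0 ?expR_ge0 //; lra.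
Qed.

(** Each choice [s] of nodes contributes the exponential of a linear form with vector [E^T *m v s].
    As [E^T] is an isometry, Hoeffding costs |v s|^2/8, a sum over coordinates; the total factors
    again, with one [nodes_mass] per dimension. *)
Lemma mean_proj_mix (k : nat) (E : 'M[R]_(k, N)) (K : nat) :
  E *m E^T = 1%:M -> mean p (fun b => proj_mix E K (noise p b)) <= 8 ^+ k.
Proof.
move=> EE.
pose c (s : {ffun 'I_k -> bool * 'I_K.+1}) :=
  \prod_i (3 * expR (- (node R (s i) ^+ 2 / 4))).
pose v (s : {ffun 'I_k -> bool * 'I_K.+1}) : 'cV[R]_k := \col_i node R (s i).
have mixE b : proj_mix E K (noise p b) =
    \sum_s c s * expR (dot (E^T *m v s) (noise p b)).
  rewrite /proj_mix; under eq_bigr do rewrite mulr_sumr.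
  rewrite bigA_distr_bigA /=; apply: eq_bigr => s _.
  rewrite dotC dot_trmul /dot expR_sum -big_split /=; apply: eq_bigr => i _.
  rewrite -[RHS]mulrA -expRD; congr (_ * expR _); rewrite [v s i 0]mxE.
  by rewrite [RHS]addrC [in RHS]mulrC.
have -> : mean p (fun b => proj_mix E K (noise p b)) =
    mean p (fun b => \sum_s c s * expR (dot (E^T *m v s) (noise p b))).
  by apply: eq_bigr => b _; rewrite mixE.
rewrite mean_sum.
apply: (@le_trans _ _
  (\sum_(s : {ffun 'I_k -> bool * 'I_K.+1}) \prod_i (3 * expR (- (node R (s i) ^+ 2 / 8))))).
  apply: ler_sum => s _.
  apply: (@le_trans _ _ (c s * expR (sqnorm (v s) / 8))).
    rewrite ler_wpM2l //; first by apply: prodr_ge0 => i _; rewrite mulr_ge0 ?expR_ge0.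
    by rewrite -(sqnorm_trmul (v s) EE) mean_expR_dot.
  rewrite /sqnorm mulr_suml expR_sum -big_split /=; apply: ler_prod => i _.
  rewrite -(mulrA 3) -expRD mxE mulr_ge0 ?expR_ge0 //= ler_pM2l // ler_expR.
  by lra.
rewrite -(bigA_distr_bigA (fun i x => 3 * expR (- (node R x ^+ 2 / 8)))) /=.
rewrite -[k in leRHS]card_ord -prodr_const; apply: ler_prod => i _.
by rewrite -mulr_sumr nodes_mass andbT mulr_ge0 // sumr_ge0 // => *; rewrite expR_ge0.
Qed.
End Mean.

Lemma proj_mix_ge0 (R : realType) (k N : nat) (E : 'M[R]_(k, N))
    (K : nat) (u : 'cV[R]_N) :
  0 <= proj_mix E K u.
Proof.
by apply: prodr_ge0 => i _; rewrite mulr_ge0 // sumr_ge0 // => *; rewrite expR_ge0.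
Qed.

(** The grid size [N] is enough: entries of orthonormal rows and of [u] have absolute value at most
    1, so every coordinate of [E *m u] is at most [N] in absolute value. *)
Lemma expR_sqnorm_le_mix (R : realType) (k N : nat) (E : 'M[R]_(k, N))
    (u : 'cV[R]_N) :
  E *m E^T = 1%:M -> (forall i, `|u i 0| <= 1) ->
  expR (sqnorm (E *m u)) <= proj_mix E N u.
Proof.
move=> EE u1; rewrite /sqnorm expR_sum; apply: ler_prod => i _.
rewrite expR_ge0 /= expR_sqr_le_nodes // mxE.
apply: le_trans (ler_norm_sum _ _ _) _.
rewrite -[N in N%:R]card_ord -sumr_const; apply: ler_sum => j _.
rewrite normrM mulr_ile1 //.
have : \sum_j E i j ^+ 2 = 1.
  move/matrixP: EE => /(_ i i); rewrite [RHS]mxE eqxx [LHS]mxE mulr1n => <-.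
  by apply: eq_bigr => l _; rewrite mxE expr2.
rewrite (bigD1 j) //= => S1.
have : E i j ^+ 2 <= 1.
  by rewrite -S1 lerDl sumr_ge0 // => l _; exact: sqr_ge0.
by rewrite -[E i j ^+ 2]real_normK ?num_real // expr_le1.
Qed.

(** * Weights of the models *)

Lemma ffact_leq_expn (k r : nat) : (k ^_ r <= k ^ r)%N.
Proof.
elim: r k => [|r IH] [|k] //; rewrite ffactSS expnS leq_mul2l /=.
by apply: leq_trans (IH k) _; case: (r) => // s; rewrite leq_exp2r.
Qed.

(** Combines C(k, r) r! <= k^r with r^r <= r! e^r and e <= 3. *)
Lemma bin_powr_le (R : realType) (k r : nat) :
  'C(k, r)%:R * r%:R ^+ r <= (3 * k%:R) ^+ r :> R.
Proof.
apply: (@le_trans _ _ ('C(k, r)%:R * (r`!%:R * 3 ^+ r))).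
  rewrite ler_wpM2l //; apply: le_trans (ler_exp_fact R r) _.
  rewrite ler_wpM2l // -[r%:R]mulr1 expRM_natl.
  by rewrite lerXn2r ?nnegrE ?expR_ge0 ?expR1_le3.
rewrite mulrA -natrM bin_ffact exprMn mulrC ler_wpM2l ?exprn_ge0 //.
by rewrite -natrX ler_nat ffact_leq_expn.
Qed.

(** The supports of size r contribute at most (3k/(25q))^r <= 4^(-r), and these sum to at most 1/3
    over r >= 1. *)
Lemma sum_supports_le (R : realType) (k : nat) (q : R) : k%:R <= q ->
  \sum_(J : {set 'I_k} | (0 < #|J|)%N) (#|J|%:R / (25 * q)) ^+ #|J| <= 1 / 2 :> R.
Proof.
move=> kq; have [kz|kpos] := posnP k.
  rewrite big_pred0 // => J; apply: negbTE; rewrite -leqNgt.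
  by apply: leq_trans (max_card J) _; rewrite card_ord kz.
have q0 : 0 < q by apply: lt_le_trans kq; rewrite ltr0n.
have cardJ (J : {set 'I_k}) : (#|J| < k.+1)%N.
  by rewrite ltnS -[k in (_ <= k)%N]card_ord max_card.
rewrite (partition_big (fun J : {set 'I_k} => inord #|J| : 'I_k.+1) (fun r => 0 < r)%N) /=;
  last by move=> J J0; rewrite inordK.
apply: (@le_trans _ _ (\sum_(r < k.+1 | (0 < r)%N) (4^-1) ^+ r)).
  apply: ler_sum => r r0.
  have eqJ (J : {set 'I_k}) :
      (0 < #|J|)%N && (inord #|J| == r) = (J \in [set A : {set 'I_k} | #|A| == r]%SET).
    rewrite inE -val_eqE /= inordK //.
    by apply: andb_idl => /eqP ->.
  rewrite (eq_bigl _ _ eqJ) (eq_bigr (fun=> (r%:R / (25 * q)) ^+ r)); last first.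
    by move=> J; rewrite inE => /eqP ->.
  rewrite sumr_const card_draws card_ord -[_ *+ 'C(_, _)]mulr_natl expr_div_n mulrA.
  rewrite ler_pdivrMr ?exprn_gt0 ?mulr_gt0 //.
  apply: le_trans (bin_powr_le R k r) _.
  by rewrite -exprMn; have := ler0n R k => k0; rewrite lerXn2r ?nnegrE; lra.
rewrite big_mkcond big_ord_recl /= add0r.
under eq_bigr do rewrite exprS.
rewrite -mulr_sumr; have := sum_exprV4_le R k; lra.
Qed.

Lemma sum_inv_sqr_le (R : realType) (n : nat) :
  \sum_(m < n.+1 | (0 < m)%N) m%:R ^- 2 <= 2 :> R.
Proof.
have [->|n0] := posnP n; first by rewrite big_mkcond big_ord1 /=.
(* The stronger bound telescopes: 1/(n+1)^2 <= 1/n - 1/(n+1). *)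
suff : \sum_(m < n.+1 | (0 < m)%N) m%:R ^- 2 <= 2 - n%:R^-1 :> R.
  by have : 0 <= n%:R^-1 :> R by []; lra.
case: n n0 => // n _; elim: n => [|n IH].
  by rewrite big_mkcond !big_ord_recr big_ord0 /= invr1 expr1n invr1; lra.
rewrite big_mkcond big_ord_recr -big_mkcond /=.
apply: (@le_trans _ _ (2 - n.+1%:R^-1 + n.+2%:R ^- 2)); first by rewrite lerD2r.
have n1 : 1 <= n.+1%:R :> R by rewrite ler1n.
have -> : n.+2%:R = n.+1%:R + 1 :> R by rewrite -natr1.
move: n1; set a := n.+1%:R => a1.
suff : 0 <= a^-1 - (a + 1)^-1 - (a + 1) ^- 2.
  by move: (a^-1) ((a + 1)^-1) ((a + 1) ^- 2) => x y z; lra.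
have -> : a^-1 - (a + 1)^-1 - (a + 1) ^- 2 = a^-1 * (a + 1) ^- 2.
  by field; lra.
by rewrite mulr_ge0 ?invr_ge0 ?exprn_ge0 //; lra.
Qed.

(** With l = ln(25q/r) >= ln 25 and 8^4 <= 25^3, (r+1) ln 8 <= 2r ln 8 <= (3/2) r l. So the 11/4 of
    r l in half the penalty covers this and the r l on the right, and 11/2 of ln c covers 2 ln c. *)
Lemma expR_pen_le (R : realType) (c q : R) (r : nat) :
  1 <= c -> (0 < r)%N -> r%:R <= q ->
  expR (- ((11 * ln c + 11 / 2 * r%:R * ln (25 * q / r%:R)) / 2)) * 8 ^+ r.+1 <=
  c ^- 2 * (r%:R / (25 * q)) ^+ r.
Proof.
move=> c1 r0 rq.
have r1 : 1 <= r%:R :> R by rewrite ler1n.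
have q0 : 0 < q by lra.
set l := ln (25 * q / r%:R).
have l25 : ln 25 <= l.
  rewrite ler_ln ?posrE ?divr_gt0 ?mulr_gt0 //; try lra.
  by rewrite ler_pdivlMr; lra.
have l8 : 4 * ln 8 <= 3 * ln 25 :> R.
  have -> : 4 * ln 8 = ln (8 ^+ 4) :> R by rewrite lnXn // mulr_natl.
  have -> : 3 * ln 25 = ln (25 ^+ 3) :> R by rewrite lnXn // mulr_natl.
  by rewrite ler_ln ?posrE ?exprn_gt0 //; lra.
have lc : 0 <= ln c := ln_ge0 c1.
have -> : 8 ^+ r.+1 = expR (r.+1%:R * ln 8) :> R.
  by rewrite expRM_natl lnK // posrE.
have -> : c ^- 2 = expR (- (2 * ln c)).
  by rewrite expRN expRM_natl lnK // posrE; lra.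
have -> : (r%:R / (25 * q)) ^+ r = expR (- (r%:R * l)).
  rewrite expRN expRM_natl -exprVn -invf_div lnK // posrE.
  by rewrite divr_gt0 ?mulr_gt0 //; lra.
have l80 : 0 <= ln 8 :> R by rewrite ln_ge0 //; lra.
rewrite -!expRD ler_expR -[r.+1]addn1 natrD.
have h1 : (r%:R + 1) * ln 8 <= 2 * r%:R * ln 8 :> R by nra.
have h2 : r%:R * (4 * ln 8) <= r%:R * (3 * l) :> R by rewrite ler_wpM2l //; lra.
have h3 : 0 <= r%:R * l by rewrite mulr_ge0 //; lra.
nra.
Qed.

(** * Events determined by finitely many Boolean variables *)

Section FiniteLaw.
Context {d : measure_display} {T : measurableType d} {R : realType}.
Variables (P : probability T R) (N : nat) (X : 'I_N -> T -> bool) (p : 'I_N -> R).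

Definition outcome (w : T) : {ffun 'I_N -> bool} := [ffun i => X i w].

Hypothesis mX : forall b, measurable (outcome @^-1` [set b]).
Hypothesis PX : forall b, P (outcome @^-1` [set b]) = (\prod_i bern (p i) (b i))%:E.

(** The integrand is a simple function, the sum over [b] of [g b] times the indicator of
    [outcome = b]. This links [P] with the finite sums [mean]. *)
Lemma integral_outcome (g : {ffun 'I_N -> bool} -> R) : (forall b, 0 <= g b) ->
  (\int[P]_w (g (outcome w))%:E = (mean p g)%:E)%E.
Proof.
move=> g0.
have gE w : (g (outcome w))%:E =
    (\sum_b ((g b)%:E * (\1_(outcome @^-1` [set b]) w)%:E))%E.
  rewrite (bigD1 (outcome w)) //= big1 ?adde0; last first.
    move=> b bw; rewrite indicE memNset ?mule0 //=.
    by move=> wb; rewrite wb eqxx in bw.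
  by rewrite indicE mem_set ?mule1.
under eq_integral do rewrite gE.
rewrite ge0_integral_sum //; last 2 first.
- move=> b; apply: measurable_funeM; apply/measurable_EFinP.
  exact: measurable_indic.
- by move=> b w _; rewrite mule_ge0 // lee_fin.
rewrite /mean -sumEFin; apply: eq_bigr => b _.
rewrite ge0_integralZl_EFin //; last first.
  by apply/measurable_EFinP; exact: measurable_indic.
rewrite EFinM -PX; congr (_ * _)%E.
by rewrite integral_indic // setIT.
Qed.

Lemma measurable_outcome (Q : pred {ffun 'I_N -> bool}) :
  measurable [set w | Q (outcome w)].
Proof.
have -> : [set w | Q (outcome w)] =
    \big[setU/set0]_(b | Q b) (outcome @^-1` [set b]).
  apply/seteqP; split => w /=.
    by move=> Qw; rewrite -bigcup_seq_cond; exists (outcome w) => //=; rewrite mem_index_enum.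
  by rewrite -bigcup_seq_cond => -[b /= /andP[_ Qb] ->].
by apply: bigsetU_measurable => b _; exact: mX.
Qed.

Lemma measurable_fun_outcome (g : {ffun 'I_N -> bool} -> R) :
  measurable_fun setT (g \o outcome).
Proof.
move=> _ Y _; rewrite setTI.
have -> : (g \o outcome) @^-1` Y = [set w | `[< Y (g (outcome w)) >]].
  by apply/seteqP; split => w /= /asboolP.
exact: (measurable_outcome (fun b => `[< Y (g b) >])).
Qed.

Lemma probability_outcome (Q : pred {ffun 'I_N -> bool}) :
  P [set w | Q (outcome w)] = (mean p (fun b => (Q b)%:R))%:E.
Proof.
rewrite -integral_outcome; last by move=> b; exact: ler0n.
rewrite -[[set w | _] in LHS]setIT -integral_indic //; last exact: measurable_outcome.
by apply: eq_integral => w _; rewrite indicE mem_setE.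
Qed.
End FiniteLaw.

(** * Coordinates of vectorized tensors *)

(** Identifies a coordinate of the stacked vector with an edge and a time, the index set of the
    independent family of observations. *)
Definition coord (n L : nat) (i : 'I_(dimNL n L)) : edge n * 'I_L :=
  (enum_val (tagnat.sig2 i), tagnat.sig1 i).

Definition coord_inv (n L : nat) (x : edge n * 'I_L) : 'I_(dimNL n L) :=
  @tagnat.Rank L (fun=> dimN n) x.2 (enum_rank x.1).

Lemma coordK (n L : nat) : cancel (@coord n L) (@coord_inv n L).
Proof.
move=> i; rewrite /coord_inv /coord /= enum_valK.
exact: tagnat.sig2K.
Qed.

Lemma coord_invK (n L : nat) : cancel (@coord_inv n L) (@coord n L).
Proof.
move=> [e l]; rewrite /coord /coord_inv /=; congr (_, _); last exact: tagnat.Rank1K.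
rewrite tagnat.Rank2K.
rewrite -[RHS]enum_rankK; congr enum_val; exact: val_inj.
Qed.

Lemma coord_bij (n L : nat) : bijective (@coord n L).
Proof. by exists (@coord_inv n L); [exact: coordK|exact: coord_invK]. Qed.

Lemma vectorizeE (R : realType) (n L : nat) (A : tensor R n L)
    (i : 'I_(dimNL n L)) :
  vectorize A i 0 = A (val (coord i).1).1 (val (coord i).1).2 (coord i).2.
Proof. by rewrite mxE mxE. Qed.

Lemma sum_edge (R : realType) (n : nat) (f : 'I_n * 'I_n -> R) :
  \sum_(e : edge n) f (val e) = \sum_(p : 'I_n * 'I_n | (p.1 < p.2)%N) f p.
Proof. by rewrite -big_sub. Qed.

(** By symmetry each pair i < j is counted twice in the tensor norm, and the diagonal contributes
    zero. *)
Lemma sqnorm_tensor_vectorize (R : realType) (n L : nat) (A : tensor R n L) :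
  sym0_tensor A -> sqnorm_tensor A = 2 * sqnorm (vectorize A).
Proof.
move=> [Asym A0].
pose f (p : 'I_n * 'I_n) := \sum_l A p.1 p.2 l ^+ 2.
have -> : sqnorm (vectorize A) = \sum_(p : 'I_n * 'I_n | (p.1 < p.2)%N) f p.
  rewrite -sum_edge pair_big /=.
  rewrite [RHS](reindex (@coord n L)) /=; last exact/onW_bij/coord_bij.
  by apply: eq_bigr => i _; rewrite vectorizeE.
rewrite /sqnorm_tensor (pair_big _ _ (fun i j => f (i, j))) /=.
have -> : \sum_(p : 'I_n * 'I_n) f (p.1, p.2) = \sum_p f p.
  by apply: eq_bigr => -[].
rewrite (bigID (fun p : 'I_n * 'I_n => p.1 < p.2)%N) /= mulr_natl mulr2n; congr (_ + _).
rewrite (bigID (fun p : 'I_n * 'I_n => p.2 < p.1)%N) /= [X in _ + X]big1 ?addr0; last first.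
  move=> [i j] /=; rewrite -!leqNgt -eqn_leq => /eqP/val_inj ->.
  by apply: big1 => l _; rewrite A0 expr0n.
pose sw (p : 'I_n * 'I_n) := (p.2, p.1).
rewrite (reindex sw) /=; last by exists sw => -[].
apply: eq_big => [[i j]|[i j] _] /=.
  by rewrite -leqNgt; apply: andb_idl; exact: ltnW.
by apply: eq_bigr => l _; rewrite Asym.
Qed.

Lemma vectorizeB (R : realType) (n L : nat) (A A' : tensor R n L) :
  vectorize (fun i j l => A i j l - A' i j l) = vectorize A - vectorize A'.
Proof.
apply/colP => i; rewrite mxE [in RHS]mxE.
by rewrite [LHS]mxE !mxE.
Qed.

Lemma sym0_tensorB (R : realType) (n L : nat) (A A' : tensor R n L) :
  sym0_tensor A -> sym0_tensor A' ->
  sym0_tensor (fun i j l => A i j l - A' i j l).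
Proof.
move=> [As A0] [As' A0']; split=> [i j l|i l]; first by rewrite As As'.
by rewrite A0 A0' subrr.
Qed.

(** * The oracle inequality for a fixed outcome *)

Section Oracle.
Variables (R : realType) (n L : nat) (H : 'M[R]_L).
Variable CC : forall m : nat, {set clustering_seq m n L}.
Hypothesis hCC : forall m : nat, (1 <= m <= n)%N ->
  (0 < #|CC m|)%N /\ 2 * ln m%:R <= ln #|CC m|%:R :> R.

(** A candidate without its coefficients. These form a finite type, so they can be summed and
    minimized over; the value m = 0 is removed by [adm_model]. *)
Definition model := {m : 'I_n.+1 & ({set 'I_(dimML m L)} * clustering_seq m n L)%type}.

Definition mcl (x : model) : nat := tag x.
Definition msupp (x : model) : {set 'I_(dimML (mcl x) L)} := (tagged x).1.
Definition mclus (x : model) : clustering_seq (mcl x) n L := (tagged x).2.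

Definition adm_model (x : model) : bool :=
  (0 < mcl x)%N && ((0 < #|msupp x|)%N && (mclus x \in CC (mcl x))).

Definition design (x : model) : 'M[R]_(dimNL n L, dimML (mcl x) L) :=
  Cmx R (mclus x) *m (Wmx (mcl x) H)^T.

Definition model_rows (x : model) : 'M[R]_(#|msupp x|, dimNL n L) :=
  rowsub (fun j : 'I_#|msupp x| => enum_val j) (design x)^T.

Lemma design_sub_rows (x : model) (v : 'cV[R]_(dimML (mcl x) L)) :
  (forall j, j \notin msupp x -> v j 0 = 0) ->
  ((design x *m v)^T <= model_rows x)%MS.
Proof.
move=> v0; rewrite trmx_mul mulmx_sum_row; apply: summx_sub => j _.
rewrite mxE; have [jJ|/v0 ->] := boolP (j \in msupp x); last by rewrite scale0r sub0mx.
apply: scalemx_sub.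
have -> : row j (design x)^T = row (enum_rank_in jJ j) (model_rows x).
  by apply/rowP => i; rewrite !mxE enum_rankK_in.
exact: row_sub.
Qed.

Definition model_of (c : candidate R n L) (hc : (cl c < n.+1)%N) : model :=
  existT (fun m : 'I_n.+1 => ({set 'I_(dimML m L)} * clustering_seq m n L)%type)
    (Ordinal hc) (supp c, clus c).

Lemma dimML_le (m : nat) : (dimML m L <= m ^ 2 * L)%N.
Proof.
rewrite /dimML sum_nat_const card_ord mulnC leq_mul2r card_cpair.
apply/orP; right; case: m => // m.
apply: (@leq_trans (((m.+1 ^ 2).*2)./2)); last by rewrite doubleK.
apply: half_leq; rewrite -mul2n -mulnn mulnCA leq_mul2l mul2n -addnn addnS ltnS.
by rewrite leq_addr.
Qed.

Lemma card_supp_le (m : nat) (J : {set 'I_(dimML m L)}) :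
  #|J|%:R <= m%:R ^+ 2 * L%:R :> R.
Proof.
rewrite -natrX -natrM ler_nat; apply: leq_trans (max_card J) _.
by rewrite card_ord dimML_le.
Qed.

Lemma pen_ge0 (m : nat) (J : {set 'I_(dimML m L)}) :
  (1 <= m <= n)%N -> (0 < #|J|)%N -> 0 <= pen R CC #|J| m.
Proof.
move=> hm J0; have [C0 _] := hCC hm.
have r1 : 1 <= #|J|%:R :> R by rewrite ler1n.
rewrite /pen; apply: addr_ge0; first by rewrite mulr_ge0 ?ln_ge0 ?ler1n.
apply: mulr_ge0; first lra.
rewrite ln_ge0 // ler_pdivlMr ?mul1r; last lra.
by rewrite -mulrA; have := card_supp_le J; lra.
Qed.

(** [expR_pen_le] bounds a weight by |CC|^(-2) times a term in J. Summing over Z leaves |CC|^(-1) <=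
    m^(-2), summing over J gives at most 1/2, and summing over m at most 2. *)
Lemma sum_model_weights_le :
  \sum_(x | adm_model x) expR (- (pen R CC #|msupp x| (mcl x) / 2)) *
    8 ^+ #|msupp x|.+1 <= 1 :> R.
Proof.
pose w (m : nat) (J : {set 'I_(dimML m L)}) : R :=
  (#|J|%:R / (25 * (m%:R ^+ 2 * L%:R))) ^+ #|J|.
apply: (@le_trans _ _ (\sum_(x | adm_model x)
    #|CC (mcl x)|%:R ^- 2 * w (mcl x) (msupp x))).
  apply: ler_sum => -[m [J Z]] /and3P [/= m0 J0 ZC].
  have [C0 _] := hCC (m := m) ltac:(by rewrite m0 -ltnS ltn_ord).
  rewrite /pen -[25 * _ * _]mulrA; apply: expR_pen_le => //; first by rewrite ler1n.
  exact: card_supp_le.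
rewrite -(@sig_big_dep _ _ _ _
  (fun m : 'I_n.+1 => ({set 'I_(dimML m L)} * clustering_seq m n L)%type)
  (fun m : 'I_n.+1 => 0 < m)%N
  (fun m y => (0 < #|y.1|)%N && (y.2 \in CC m))
  (fun (m : 'I_n.+1) y => #|CC m|%:R ^- 2 * w m y.1)) /=.
apply: (@le_trans _ _ (\sum_(m < n.+1 | (0 < m)%N) (1 / 2) * m%:R ^- 2)); last first.
  by rewrite -mulr_sumr; have := sum_inv_sqr_le R n; lra.
apply: ler_sum => m m0.
have [C0 Cm] := hCC (m := m) ltac:(by rewrite m0 -ltnS ltn_ord).
rewrite -(pair_big (fun J : {set 'I_(dimML m L)} => 0 < #|J|)%N
  (fun Z => Z \in CC m) (fun J Z => #|CC m|%:R ^- 2 * w m J)) /=.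
under eq_bigr do rewrite sumr_const -mulrnAl.
rewrite -mulr_sumr mulrC; apply: ler_pM.
- by apply: sumr_ge0 => J _; rewrite exprn_ge0 // divr_ge0 // mulr_ge0.
- by rewrite mulrn_wge0 // invr_ge0 exprn_ge0.
- by apply: sum_supports_le; rewrite -natrX -natrM ler_nat dimML_le.
have c0 : 0 < #|CC m|%:R :> R by rewrite ltr0n.
have m0' : 0 < m%:R :> R by rewrite ltr0n.
rewrite -[leLHS]mulr_natr expr2 invfM mulfVK ?lt0r_neq0 //.
rewrite lef_pV2 ?posrE ?exprn_gt0 //.
rewrite -ler_ln ?posrE ?exprn_gt0 // lnXn //.
by apply: le_trans Cm; rewrite mulr_natl.
Qed.

(** The space is spanned by [theta] and the selected columns, whence the dimension bound. Dimension
    and basis are packed in one pair so that [choice] can pick them for all models. *)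
Lemma model_basis (theta : 'cV[R]_(dimNL n L)) (x : model) :
  exists E : {k & 'M[R]_(k, dimNL n L)},
    [/\ (tag E <= #|msupp x|.+1)%N, tagged E *m (tagged E)^T = 1%:M
      & forall v : 'cV[R]_(dimML (mcl x) L), (forall j, j \notin msupp x -> v j 0 = 0) ->
        ((design x *m v - theta)^T <= tagged E)%MS].
Proof.
have [k [E [kr EE AE _]]] := orthonormal_basis (col_mx theta^T (model_rows x)).
exists (existT (fun k => 'M[R]_(k, dimNL n L)) k E); split=> //= v v0.
rewrite linearB /=; apply: submx_trans AE.
have sA := eqmx_sym (addsmxE theta^T (model_rows x)).
apply: addmx_sub; last by rewrite eqmx_opp sA addsmxSl.
by rewrite sA; apply: submx_trans (design_sub_rows v0) (addsmxSr _ _).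
Qed.

(** [F] is fixed before [b] and [c], so one moment bound serves every minimizer, however it depends
    on the data. *)
Lemma oracle_inequality (theta : 'cV[R]_(dimNL n L)) (c0 : candidate R n L) :
  (forall i, 0 <= theta i 0 <= 1) -> admissible CC c0 ->
  exists F : {ffun 'I_(dimNL n L) -> bool} -> R,
    [/\ forall b, 1 <= F b, mean (fun i => theta i 0) F <= 9
      & forall b c,
          penalized_ls H CC (theta + noise (fun i => theta i 0) b) c ->
          2 * sqnorm (fit H c (coef c) - theta) <=
          6 * sqnorm (fit H c0 (Defs.restrict (supp c0) (coef c0)) - theta)
          + 4 * pen R CC #|supp c0| (cl c0) + 16 * ln (F b)].
Proof.
move=> th01 adm0; have [m0 J0 Z0] := adm0.
set p := fun i => theta i 0.
have [E EP] := choice (model_basis theta).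
set f0 := fit H c0 _.
have [k0 [E0 [k01 EE0 spE0 _]]] := orthonormal_basis (theta - f0)^T.
pose N := dimNL n L.
pose pw (x : model) : R := expR (- (pen R CC #|msupp x| (mcl x) / 2)).
pose F1 (b : {ffun 'I_N -> bool}) : R :=
  \sum_(x | adm_model x) pw x * proj_mix (tagged (E x)) N (noise p b).
pose F b := proj_mix E0 N (noise p b) + F1 b.
have F1_ge0 b : 0 <= F1 b.
  by apply: sumr_ge0 => x _; rewrite mulr_ge0 ?expR_ge0 ?proj_mix_ge0.
have n1 b i : `|noise p b i 0| <= 1 by exact: noise_le1.
have F0 b : expR (sqnorm (E0 *m noise p b)) <= F b.
  by rewrite -[leLHS]addr0 lerD // expR_sqnorm_le_mix.
have F_gt0 b : 0 < F b by apply: lt_le_trans (F0 b); exact: expR_gt0.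
exists F; split.
- move=> b; apply: le_trans (F0 b).
  by rewrite -expR0 ler_expR sqnorm_ge0.
(* The line spanned by [theta - f0] costs at most 8, and all the models together at most 1. *)
- rewrite meanD -[9](_ : 8 + 1 = _ :> R); last by ring.
  apply: lerD.
    apply: le_trans (mean_proj_mix th01 N EE0) _.
    by rewrite -[leRHS]expr1 ler_weXn2l //; lra.
  rewrite mean_sum; apply: le_trans sum_model_weights_le.
  apply: ler_sum => x _; rewrite ler_wpM2l ?expR_ge0 //.
  have [kx EEx _] := EP x.
  apply: le_trans (mean_proj_mix th01 N EEx) _.
  by rewrite ler_weXn2l //; lra.
move=> b c [[adm cS] cmin].
have [/andP[mc1 mcn] Jc Zc] := adm.
(* [c0] is only admissible; zeroing its coefficients off the support makes it a feasible competitor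
   with the same fit and penalty as in the oracle bound. *)
pose c1 := Candidate (supp c0) (Defs.restrict (supp c0) (coef c0)) (clus c0).
have fc1 : feasible CC c1.
  by split=> //= j jJ; rewrite mxE (negbTE jJ).
have := cmin c1 fc1; rewrite /objective /=.
rewrite -[fit H c1 _]/f0; set fc := fit H c (coef c); set xi := noise p b.
have mcS : (cl c < n.+1)%N by rewrite ltnS.
pose x := model_of mcS.
have admx : adm_model x by rewrite /adm_model /= mc1 Jc Zc.
have F1x : expR (sqnorm (tagged (E x) *m xi) - pen R CC #|supp c| (cl c) / 2) <= F b.
  have [_ EEx _] := EP x.
  rewrite -[leLHS]add0r; apply: lerD; first exact: proj_mix_ge0.
  rewrite /F1 (bigD1 x) //= -[leLHS]addr0; apply: lerD; last first.
    by apply: sumr_ge0 => y _; rewrite mulr_ge0 ?expR_ge0 ?proj_mix_ge0.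
  have -> : expR (sqnorm (tagged (E x) *m xi) - pen R CC #|supp c| (cl c) / 2) =
      pw x * expR (sqnorm (tagged (E x) *m xi)) by rewrite addrC expRD.
  apply: ler_wpM2l; first exact: expR_ge0.
  exact: expR_sqnorm_le_mix EEx (n1 b).
have l0 : sqnorm (E0 *m xi) <= ln (F b).
  by rewrite -ler_expR lnK ?posrE //; exact: F0.
have l1 : sqnorm (tagged (E x) *m xi) - pen R CC #|supp c| (cl c) / 2 <= ln (F b).
  by rewrite -ler_expR lnK ?posrE //; exact: F1x.
have [_ EEx spx] := EP x.
have d1 := dot_le_proj xi EEx (spx (coef c) cS).
rewrite -[design x *m coef c]/fc in d1.
have d0 := dot_le_proj xi EE0 spE0.
have -> : theta + xi - fc = xi + - (fc - theta).
  by rewrite opprB addrCA addrA.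
have -> : theta + xi - f0 = xi + (theta - f0) by rewrite addrCA addrA.
have sy : sqnorm (theta - f0) = sqnorm (f0 - theta) by rewrite -sqnormN opprB.
have dN : dot xi (- (fc - theta)) = - dot xi (fc - theta).
  by rewrite !dotE mulmxN mxE.
rewrite !(sqnormD xi) sqnormN dN => hmin.
(* Projections are bounded by [l0] and [l1], and the penalty of [c] cancels: |fc - theta|^2 / 2 <=
   (3/2) |f0 - theta|^2 + Pen + 4 ln F. Multiplying by 4 gives the claim. *)
by rewrite sy in hmin d0; lra.
Qed.
End Oracle.

(** * Existence of the oracle and the law of the observations *)

(** For each of the finitely many models least squares gives the best coefficients; the best model
    is then a finite minimum. *)
Lemma oracle_exists (R : realType) (n L : nat) (H : 'M[R]_L)
    (CC : forall m : nat, {set clustering_seq m n L})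
    (theta : 'cV[R]_(dimNL n L)) (c1 : candidate R n L) :
  admissible CC c1 ->
  exists2 c0 : candidate R n L, admissible CC c0
    & forall c, admissible CC c ->
        oracle_risk H CC theta c0 <= oracle_risk H CC theta c.
Proof.
move=> adm1.
have restrictE k (J : {set 'I_k}) (v : 'cV[R]_k) :
    Defs.restrict J v = diag_mx (\row_j (j \in J)%:R) *m v.
  apply/colP => j; rewrite mul_diag_mx !mxE.
  by case: ifP; rewrite ?mul1r ?mul0r.
(* The diagonal 0-1 matrix turns the restriction to J into a matrix product, so that [least_squares]
   applies. *)
pose D (x : model n L) := cid (least_squares
  (design H x *m diag_mx (\row_j (j \in msupp x)%:R)) theta).
pose cand (x : model n L) : candidate R n L :=
  Candidate (msupp x) (sval (D x)) (mclus x).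
have clP (c : candidate R n L) : admissible CC c -> (cl c < n.+1)%N.
  by case=> /andP[_ ?] _ _; rewrite ltnS.
have admP (c : candidate R n L) (hc : (cl c < n.+1)%N) :
    admissible CC c -> adm_model CC (model_of hc).
  by case=> /andP[c0 _] J0 Z0; rewrite /adm_model /= c0 J0.
pose risk x := oracle_risk H CC theta (cand x).
have := @Order.TotalTheory.arg_minP _ _ _ (model_of (clP _ adm1)) (adm_model CC) risk
  (admP _ _ adm1).
case=> x /and3P[m0 J0 Z0] xmin.
exists (cand x).
  by split=> //=; rewrite m0 /= -ltnS ltn_ord.
move=> c hc; apply: le_trans (xmin _ (admP _ (clP _ hc) hc)) _.
rewrite /risk /oracle_risk lerD2r ler_wpM2r ?invr_ge0 ?mulr_ge0 ?exprn_ge0 //.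
rewrite ler_wpM2l // !restrictE.
have := svalP (D (model_of (clP _ hc))) (coef c).
by rewrite -!(mulmxA (design H (model_of (clP _ hc)))).
Qed.

Section Observations.
Context {d : measure_display} {T : measurableType d} {R : realType}.
Variables (P : probability T R) (n L : nat) (Lam : tensor R n L).
Variable B : 'I_n -> 'I_n -> 'I_L -> {RV P >-> bool}.
Hypothesis hB : bernoulli_observations B Lam.

Definition entry (x : edge n * 'I_L) (w : T) : bool :=
  B (val x.1).1 (val x.1).2 x.2 w.

Definition obs (i : 'I_(dimNL n L)) (w : T) : bool := entry (coord i) w.

Definition obs_mean (i : 'I_(dimNL n L)) : R := vectorize Lam i 0.

Lemma measurable_entry x (E : set bool) : measurable (entry x @^-1` E).
Proof. by rewrite -[_ @^-1` _]setTI; exact: measurable_funP. Qed.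

(** Puts the event in the form of an intersection over all entries, to which mutual independence
    applies. *)
Lemma outcome_bigcap b :
  outcome obs @^-1` [set b] =
  \bigcap_(x in [set` [set: edge n * 'I_L]%SET]) entry x @^-1` [set b (coord_inv x)].
Proof.
apply/seteqP; split => w /=.
  by move=> <- x _ /=; rewrite ffunE /obs coord_invK.
move=> wb; apply/ffunP => i; rewrite ffunE /obs.
by have := wb (coord i); rewrite /= inE coordK; apply.
Qed.

Lemma measurable_obs b : measurable (outcome obs @^-1` [set b]).
Proof.
rewrite outcome_bigcap; apply: fin_bigcap_measurable; first exact: finite_finset.
by move=> x _; exact: measurable_entry.
Qed.

Lemma probability_entry x (c : bool) :
  P (entry x @^-1` [set c]) =
  (bern (Lam (val x.1).1 (val x.1).2 x.2) c)%:E.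
Proof.
have [_ _ PB _] := hB; have PT := PB (val x.1).1 (val x.1).2 x.2.
have eT : entry x @^-1` [set true] = [set w | B (val x.1).1 (val x.1).2 x.2 w].
  by apply/seteqP; split.
case: c; first by rewrite eT PT.
have -> : entry x @^-1` [set false] = ~` (entry x @^-1` [set true]).
  by apply/seteqP; split=> w /=; case: (entry x w).
by rewrite probability_setC ?eT ?PT //; rewrite -eT; exact: measurable_entry.
Qed.

Lemma probability_obs b :
  P (outcome obs @^-1` [set b]) = (\prod_i bern (obs_mean i) (b i))%:E.
Proof.
have [_ _ _ indep] := hB.
rewrite outcome_bigcap (indep [set: _]%SET (fun x => [set b (coord_inv x)])) //.
rewrite (eq_bigr (fun x : edge n * 'I_L =>
    (bern (Lam (val x.1).1 (val x.1).2 x.2) (b (coord_inv x)))%:E)); last first.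
  by move=> x _; exact: probability_entry.
rewrite prodEFin; congr EFin.
rewrite (reindex (@coord n L)) /=; last exact/onW_bij/coord_bij.
by apply: eq_big => i; rewrite ?inE // => _; rewrite coordK /obs_mean vectorizeE.
Qed.

Lemma observation_vectorE w :
  observation_vector B w = vectorize Lam + noise obs_mean (outcome obs w).
Proof.
apply/colP => i; rewrite [in RHS]mxE [noise _ _ _ _]mxE /obs_mean addrC subrK ffunE.
exact: vectorizeE.
Qed.
End Observations.

Theorem theorem1 (R : realType) (d : measure_display) (T : measurableType d)
    (P : probability T R) (n L : nat)
    (Lam : tensor R n L)
    (hLam01 : forall i j l, 0 <= Lam i j l <= 1)
    (hLam : sym0_tensor Lam)
    (hdsbm : exists m : nat, dsbm m Lam)
    (B : 'I_n -> 'I_n -> 'I_L -> {RV P >-> bool})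
    (hB : bernoulli_observations B Lam)
    (H : 'M[R]_L) (hH : H *m H^T = 1%:M)
    (CC : forall m : nat, {set clustering_seq m n L})
    (hCC : forall m : nat, (1 <= m <= n)%N ->
       [/\ forall Z, Z \in CC m -> forall l, Z l \in clustering m n,
           (0 < #|CC m|)%N
         & 2 * ln m%:R <= ln #|CC m|%:R :> R])
    (est : T -> candidate R n L)
    (hest : forall w, penalized_ls H CC (observation_vector B w) (est w))
    (Lhat : 'I_n -> 'I_n -> 'I_L -> {RV P >-> R})
    (hLhat : forall w, let Lw : tensor R n L := fun i j l => Lhat i j l w in
       sym0_tensor Lw /\ vectorize Lw = fit H (est w) (coef (est w))) :
  let loss (w : T) : R :=
    sqnorm_tensor (fun i j l => Lhat i j l w - Lam i j l)
      / (n%:R ^+ 2 * L%:R) in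
  let risk (c : candidate R n L) : R := oracle_risk H CC (vectorize Lam) c in
  (exists2 b : R,
     is_min [set risk c | c in [set c | admissible CC c]] b
   & forall t : R, 0 < t ->
       ((1 - 9 * expR (- t))%:E <=
        P [set w | (loss w <= b + 38 * t / (n%:R ^+ 2 * L%:R))%R])%E) /\
  (exists2 b : R,
     is_min [set risk c + 342 / (n%:R ^+ 2 * L%:R)
            | c in [set c | admissible CC c]] b
   & ('E_P[loss] <= b%:E)%E).
Proof.
move=> loss risk.
have hCC' m : (1 <= m <= n)%N ->
    (0 < #|CC m|)%N /\ 2 * ln m%:R <= ln #|CC m|%:R :> R.
  by move=> /hCC [].
(* [P] has mass one, so [T] has a point; the estimator there is an admissible candidate, which
   forces [n] and [L] to be positive. *)
have [w0] : exists w : T, True.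
  apply: contrapT => nT; have := probability_setT P.
  have -> : [set: T] = set0 by rewrite -subset0 => w _; apply: nT; exists w.
  by rewrite measure0 => /eqP; rewrite lt_eqF ?lte01.
move=> _; have [[adm1 _] _] := hest w0.
have [/andP[c1 c1n] J1 _] := adm1.
have n0 : (0 < n)%N by exact: leq_trans c1n.
have L0 : (0 < L)%N.
  have /card_gt0P [j _] := J1.
  have := leq_ltn_trans (leq0n j) (ltn_ord j).
  by move=> /leq_trans /(_ (dimML_le L (cl (est w0)))); rewrite muln_gt0 => /andP[].
set nL := n%:R ^+ 2 * L%:R in loss risk *.
have nL0 : 0 < nL by rewrite mulr_gt0 ?exprn_gt0 ?ltr0n.
have [c0 adm0 c0min] := oracle_exists H (vectorize Lam) adm1.
have p01 i : 0 <= vectorize Lam i 0 <= 1 by rewrite vectorizeE.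
have [F [F1 mF oracleF]] := oracle_inequality H hCC' p01 adm0.
have lossE w : loss w = 2 * sqnorm (fit H (est w) (coef (est w)) - vectorize Lam) / nL.
  rewrite /loss; congr (_ / _); have [hs <-] := hLhat w.
  by rewrite (sqnorm_tensor_vectorize (sym0_tensorB hs hLam)) vectorizeB.
have loss_le w : loss w <= risk c0 + 16 * ln (F (outcome (obs B) w)) / nL.
  rewrite lossE /risk /oracle_risk -/nL -!mulrDl ler_pM2r ?invr_gt0 //.
  by apply: oracleF; rewrite -observation_vectorE.
have loss_ge0 w : 0 <= loss w.
  by rewrite lossE divr_ge0 ?mulr_ge0 ?sqnorm_ge0 // ltW.
have mloss : measurable_fun setT loss.
  apply: measurable_funM => //; apply: measurable_sum => i.
  apply: measurable_sum => j; apply: measurable_sum => l.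
  by apply: measurable_funX; apply: measurable_funB.
have mO := measurable_obs B.
have PO := probability_obs hB.
have risk0 : 0 <= risk c0.
  have [c0n J0 _] := adm0.
  rewrite /risk /oracle_risk addr_ge0 // divr_ge0 ?mulr_ge0 ?sqnorm_ge0 ?(ltW nL0) //.
  exact: (pen_ge0 hCC').
split.
  exists (risk c0).
    by split; [exists c0|move=> _ [c cadm <-]; exact: c0min].
  move=> t t0.
  (* Markov's inequality in pointwise form: the indicator of F <= e^t is at least 1 - e^(-t) F,
     whose mean is at least 1 - 9 e^(-t). *)
  pose Q b := F b <= expR t.
  apply: (@le_trans _ _ (P [set w | Q (outcome (obs B) w)])).
    rewrite (probability_outcome mO PO) lee_fin.
    apply: (@le_trans _ _ (mean (obs_mean Lam) (fun b => 1 + (- expR (- t)) * F b))).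
      rewrite meanD mean_cst meanZ mulNr lerD2l lerN2 mulrC.
      by rewrite ler_wpM2r ?expR_ge0.
    apply: le_mean => // b; rewrite /Q; have [Fb|Fb] := leP (F b) (expR t).
      by rewrite mulNr gerBl mulr_ge0 ?expR_ge0 // (le_trans ler01).
    rewrite mulNr subr_le0 expRN mulrC ler_pdivlMr ?expR_gt0 // mul1r.
    exact: ltW.
  apply: le_measure; rewrite ?inE.
  - exact: measurable_outcome.
  - set c := risk c0 + _.
    have -> : [set w | loss w <= c] = setT `&` loss @^-1` [set` `]-oo, c]].
      by rewrite setTI; apply/seteqP; split => w /=; rewrite in_itv.
    exact: mloss measurableT _ (measurable_itv _).
  move=> w /= Qw; apply: le_trans (loss_le w) _; rewrite lerD2l.
  rewrite ler_pM2r ?invr_gt0 //.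
  (* On this event the excess is at most 16 t <= 38 t. *)
  have : ln (F (outcome (obs B) w)) <= t.
    rewrite -[t]expRK ler_ln ?posrE ?expR_gt0 //.
    by rewrite (lt_le_trans ltr01).
  lra.
exists (risk c0 + 342 / nL).
  split; first by exists c0.
  by move=> _ [c cadm <-]; rewrite lerD2r; exact: c0min.
(* From ln F <= F - 1 and a mean of [F] at most 9, the excess is at most 16 * 8 = 128 <= 342. *)
pose g b := risk c0 + 16 / nL * (F b - 1).
have g0 b : 0 <= g b.
  by rewrite addr_ge0 // mulr_ge0 ?divr_ge0 ?(ltW nL0) // subr_ge0.
rewrite unlock; apply: (@le_trans _ _ (mean (obs_mean Lam) g)%:E).
  rewrite -(integral_outcome mO PO g0); apply: ge0_le_integral => //=.
  - by move=> w _; rewrite lee_fin.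
  - exact/measurable_EFinP.
  - by apply/measurable_EFinP; exact: measurable_fun_outcome mO g.
  move=> w _; rewrite lee_fin; apply: le_trans (loss_le w) _.
  rewrite lerD2l mulrAC ler_pM2l ?divr_gt0 //.
  have Fw : 0 < F (outcome (obs B) w) by rewrite (lt_le_trans ltr01).
  by rewrite -[X in ln X](subrKC 1) le_ln1Dx //; lra.
rewrite lee_fin meanD mean_cst lerD2l meanZ meanD mean_cst -mulrAC ler_pM2r ?invr_gt0 //.
lra.
Qed.
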